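(* Let $l\ge 1$ and $k\ge 1$ be integers, and let $\tau=11\cdots1$ be the generalized pattern consisting of $l$ consecutive (unhyphenated) copies of the letter $1$. For a word $\sigma=\sigma_1\cdots\sigma_n\in[k]^n$, let $\#\tau(\sigma)$ be the number of indices $i$ with $1\le i\le n-l+1$ and $\sigma_i=\sigma_{i+1}=\cdots=\sigma_{i+l-1}$. Let \[ F_\tau(x;k;q)=\sum_{n\ge 0}\sum_{\sigma\in[k]^n} q^{\#\tau(\sigma)}x^n . \] Then, as an identity of rational functions in $x$ and $q$, \[ F_{\tau}(x;k;q)=\frac{1+(1-q)x\sum_{j=0}^{l-2} (kx)^j -(1-q)(k-1)\sum_{d=2}^{l-1}x^d\sum_{j=0}^{l-1-d} (kx)^j}{1-(k-1+q)x-(k-1)(1-q)(1-x^{l-2})\frac{x^2}{1-x}}. \]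
   Context: $[k]^n$ denotes the set of words of length $n$ over the alphabet $\{1,\dots,k\}$; $[k]^0$ consists of the empty word. Empty sums are $0$. *)

(* Defs.v *)
From HB Require Import structures.
From mathcomp Require Import all_boot all_order all_algebra.
From mathcomp Require Import boolp.

Set Implicit Arguments.
Unset Strict Implicit.
Unset Printing Implicit Defensive.

Import GRing.Theory.
Local Open Scope ring_scope.

(* Formal power series over R, as coefficient sequences with the Cauchy
   product.  Over an integral domain they form an integral domain, so that
   {fraction fps R} is a field; through fps_of_poly, which is an injective
   ring morphism, this field contains the rational functions over R. *)

Record fps (R : Type) := Fps { fps_coef : nat -> R }.

Lemma fpsP (R : Type) (f g : fps R) : fps_coef f =1 fps_coef g -> f = g.
Proof. by case: f g => [f] [g] /= /funext ->. Qed.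

HB.instance Definition _ (R : Type) := gen_eqMixin (fps R).
HB.instance Definition _ (R : Type) := gen_choiceMixin (fps R).

Definition fps_add (R : zmodType) (f g : fps R) : fps R :=
  Fps (fun n => fps_coef f n + fps_coef g n).

Definition fps_opp (R : zmodType) (f : fps R) : fps R :=
  Fps (fun n => - fps_coef f n).

Lemma fps_addA (R : zmodType) : associative (@fps_add R).
Proof. by move=> f g h; apply: fpsP => n /=; rewrite addrA. Qed.

Lemma fps_addC (R : zmodType) : commutative (@fps_add R).
Proof. by move=> f g; apply: fpsP => n /=; rewrite addrC. Qed.

Lemma fps_add0 (R : zmodType) : left_id (Fps (fun=> 0)) (@fps_add R).
Proof. by move=> f; apply: fpsP => n /=; rewrite add0r. Qed.

Lemma fps_addN (R : zmodType) :
  left_inverse (Fps (fun=> 0)) (@fps_opp R) (@fps_add R).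
Proof. by move=> f; apply: fpsP => n /=; rewrite addNr. Qed.

HB.instance Definition _ (R : zmodType) := GRing.isZmodule.Build (fps R)
  (@fps_addA R) (@fps_addC R) (@fps_add0 R) (@fps_addN R).

Definition fps_of_poly (R : nzRingType) (p : {poly R}) : fps R :=
  Fps (fun n => p`_n).

Definition fps_mul (R : nzRingType) (f g : fps R) : fps R :=
  Fps (fun n => \sum_(i < n.+1) fps_coef f i * fps_coef g (n - i)%N).

Definition fps_trunc (R : nzRingType) (m : nat) (f : fps R) : {poly R} :=
  \poly_(i < m.+1) fps_coef f i.

Lemma coef_fps_trunc (R : nzRingType) m (f : fps R) n :
  (n <= m)%N -> (fps_trunc m f)`_n = fps_coef f n.
Proof. by move=> le_nm; rewrite coef_poly ltnS le_nm. Qed.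

Lemma fps_mul_coefM (R : nzRingType) (f g : fps R) (p r : {poly R}) n :
  (forall i, (i <= n)%N -> fps_coef f i = p`_i) ->
  (forall i, (i <= n)%N -> fps_coef g i = r`_i) ->
  fps_coef (fps_mul f g) n = (p * r)`_n.
Proof.
move=> fp gr; rewrite coefM; apply: eq_bigr => i _.
by rewrite fp ?gr ?leq_subr // -ltnS.
Qed.

Lemma fps_mul_trunc (R : nzRingType) (f g : fps R) m n : (n <= m)%N ->
  fps_coef (fps_mul f g) n = (fps_trunc m f * fps_trunc m g)`_n.
Proof.
by move=> le_nm; apply: fps_mul_coefM => i le_in;
  rewrite coef_fps_trunc // (leq_trans le_in).
Qed.

Lemma fps_mulA (R : nzRingType) : associative (@fps_mul R).
Proof.
move=> f g h; apply: fpsP => n.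
rewrite (@fps_mul_coefM _ _ _ (fps_trunc n f) (fps_trunc n g * fps_trunc n h));
  last 2 first.
- by move=> i le_in; rewrite coef_fps_trunc.
- by move=> i le_in; rewrite (fps_mul_trunc _ _ le_in).
rewrite mulrA; symmetry; apply: fps_mul_coefM => i le_in.
  by rewrite (fps_mul_trunc _ _ le_in).
by rewrite coef_fps_trunc.
Qed.

Lemma fps_mulC (R : comNzRingType) : commutative (@fps_mul R).
Proof.
by move=> f g; apply: fpsP => n; rewrite !(fps_mul_trunc _ _ (leqnn n)) mulrC.
Qed.

Lemma fps_mul1 (R : nzRingType) : left_id (fps_of_poly 1) (@fps_mul R).
Proof.
move=> f; apply: fpsP => n.
rewrite (@fps_mul_coefM _ _ _ 1 (fps_trunc n f)) //.
  by rewrite mul1r coef_fps_trunc.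
by move=> i le_in; rewrite coef_fps_trunc.
Qed.

Lemma fps_mulDl (R : nzRingType) :
  left_distributive (@fps_mul R) (@fps_add R).
Proof.
move=> f g h; apply: fpsP => n /=.
by rewrite -big_split; apply: eq_bigr => i _; rewrite mulrDl.
Qed.

Lemma fps_1_neq0 (R : nzRingType) : fps_of_poly 1 != 0 :> fps R.
Proof.
apply/eqP => /(congr1 (fun f => fps_coef f 0)) /=.
by rewrite coef1 => /eqP; rewrite oner_eq0.
Qed.

HB.instance Definition _ (R : comNzRingType) :=
  GRing.Zmodule_isComNzRing.Build (fps R)
    (@fps_mulA R) (@fps_mulC R) (@fps_mul1 R) (@fps_mulDl R) (@fps_1_neq0 R).

Lemma fps_of_poly_additive (R : comNzRingType) :
  zmod_morphism (@fps_of_poly R).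
Proof. by move=> p r; apply: fpsP => n /=; rewrite coefB. Qed.

Lemma fps_of_poly_multiplicative (R : comNzRingType) :
  monoid_morphism (@fps_of_poly R).
Proof.
by split=> // p r; apply: fpsP => n; rewrite -[RHS]/(fps_coef (fps_mul _ _) n)
  (@fps_mul_coefM _ _ _ p r).
Qed.

HB.instance Definition _ (R : comNzRingType) :=
  GRing.isZmodMorphism.Build _ _ (@fps_of_poly R) (@fps_of_poly_additive R).
HB.instance Definition _ (R : comNzRingType) :=
  GRing.isMonoidMorphism.Build _ _ (@fps_of_poly R)
    (@fps_of_poly_multiplicative R).

Lemma fps_of_poly_inj (R : nzRingType) : injective (@fps_of_poly R).
Proof. by move=> p r /(congr1 (@fps_coef R)) /= eq_pr; apply/polyP => n; exact: (congr1 (@^~ n) eq_pr). Qed.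

Definition fps_unit (R : comNzRingType) : {pred fps R} :=
  fun f => `[< exists g, g * f = 1 >].

Definition fps_inv (R : comNzRingType) (f : fps R) : fps R :=
  if pselect (exists g, g * f = 1) is left e then projT1 (cid e) else f.

Lemma fps_mulVx (R : comNzRingType) :
  {in @fps_unit R, left_inverse 1 (@fps_inv R) *%R}.
Proof.
move=> f /asboolP f_unit; rewrite /fps_inv; case: pselect => // e.
by case: (cid e).
Qed.

Lemma fps_unitPl (R : comNzRingType) (f g : fps R) : g * f = 1 -> fps_unit f.
Proof. by move=> gf1; apply/asboolP; exists g. Qed.

Lemma fps_inv_out (R : comNzRingType) :
  {in [predC @fps_unit R], @fps_inv R =1 id}.
Proof.
move=> f /negP f_nunit; rewrite /fps_inv; case: pselect => // e.
by case: f_nunit; apply/asboolP.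
Qed.

HB.instance Definition _ (R : comNzRingType) :=
  GRing.ComNzRing_hasMulInverse.Build (fps R)
    (@fps_mulVx R) (@fps_unitPl R) (@fps_inv_out R).

Lemma fps_neq0_order (R : nzRingType) (f : fps R) : f != 0 ->
  exists2 m, fps_coef f m != 0 & forall i, (i < m)%N -> fps_coef f i = 0.
Proof.
move=> f_neq0; have exf : exists n, fps_coef f n != 0.
  apply: contrapT => f_eq0; move/eqP: f_neq0; apply; apply: fpsP => n.
  by apply/eqP; apply: contrapT => /negP fn; apply: f_eq0; exists n.
case: (ex_minnP exf) => m fm min_m; exists m => // i lt_im.
by apply/eqP; apply: contraLR lt_im; rewrite -leqNgt => /min_m.
Qed.

Lemma fps_mulf_eq0 (R : idomainType) : GRing.integral_domain_axiom (fps R).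
Proof.
move=> f g fg0; rewrite -[_ || _]negbK negb_or; apply/negP.
case/andP=> /fps_neq0_order[m fm minf] /fps_neq0_order[n gn ming].
have /eqP : fps_coef (f * g) (m + n)%N = 0 by rewrite fg0.
rewrite /= (bigD1 (inord m)) //= inordK ?ltnS ?leq_addr // addKn.
rewrite big1 ?addr0 ?mulf_eq0 ?(negPf fm) ?(negPf gn) // => i neq_im.
have [lt_im|lt_mi|eq_im] := ltngtP i m; first by rewrite minf ?mul0r.
  by rewrite ming ?mulr0 // ltn_subLR ?ltn_add2r // -ltnS.
by case/eqP: neq_im; apply: val_inj; rewrite /= inordK ?ltnS ?leq_addr.
Qed.

HB.instance Definition _ (R : idomainType) :=
  GRing.ComUnitRing_isIntegral.Build (fps R) (@fps_mulf_eq0 R).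

(* Positions are counted from 0, so i ranges over 0 <= i <= n - l. *)
Definition occurrences (l k n : nat) (s : n.-tuple 'I_k) : nat :=
  #|[set i : 'I_(n.+1 - l) | constant (take l (drop i s))]|.

(* As a power series in x with coefficients in Z[q]; 'X below is q. *)
Definition F_tau (l k : nat) : fps {poly int} :=
  Fps (fun n => \sum_(s : n.-tuple 'I_k) 'X ^+ occurrences l s).

(* Main.v *)
(* Fix a letter c and let f_m be the generating function of the words w weighted
   by q ^ #tau(c^m w), so that f_0 = F.  Splitting on the first letter of w
   gives f_m = G_c + x f_{m+1} for m < l, where G_c = 1 + x sum_{d <> c} f_1(d), since
   a run shorter than l that is broken by another letter contributes no
   occurrence; moreover f_l = q f_{l-1}.  Eliminating f_1, ..., f_l yields
   (1 - q x) F = G_c N with N = 1 + (1 - q)(x + ... + x^{l-1}).  Summing over c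
   and using F = 1 + x sum_d f_1(d) leaves the linear equation
   F (k (1 - q x) - (k - 1) N) = N.  The stated fraction is N over this factor:
   in its numerator the coefficient of x^m, for 0 < m < l, is (1 - q) times
   k^(m-1) - (k - 1)(1 + k + ... + k^(m-2)) = 1. *)

Require Import Defs.
From mathcomp Require Import all_boot all_order all_algebra.
From mathcomp Require Import ring.

Set Implicit Arguments.
Unset Strict Implicit.
Unset Printing Implicit Defensive.

Import GRing.Theory.
Local Open Scope ring_scope.

(** * Occurrences in sequences and runs of one letter *)

Definition seq_occurrences {T : eqType} (l : nat) (s : seq T) : nat :=
  count (fun i => constant (take l (drop i s))) (iota 0 ((size s).+1 - l)).

Lemma occurrencesE (l k n : nat) (s : n.-tuple 'I_k) :
  occurrences l s = seq_occurrences l s.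
Proof.
rewrite /occurrences cardE /enum_mem size_filter -enumT.
rewrite /seq_occurrences size_tuple -val_enum_ord count_map.
by apply: eq_count => i; rewrite !inE.
Qed.

Section SeqOccurrences.
Variables (T : eqType) (l : nat).
Implicit Types (c d : T) (s : seq T).

Lemma seq_occurrences_small s : (size s < l)%N -> seq_occurrences l s = 0%N.
Proof. by rewrite /seq_occurrences -subn_eq0 => /eqP ->. Qed.

Lemma seq_occurrences_cons c s :
  seq_occurrences l (c :: s) =
    ((l <= (size s).+1)%N && constant (take l (c :: s)) + seq_occurrences l s)%N.
Proof.
rewrite /seq_occurrences /=; case: leqP => [le_ls | lt_sl]; last first.
  have /eqP -> : ((size s).+2 - l == 0)%N by rewrite subn_eq0.
  by have /eqP -> : ((size s).+1 - l == 0)%N by rewrite subn_eq0 ltnW.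
by rewrite subSn //= (iotaDl 1 0) count_map.
Qed.

Lemma seq_occurrences_nseq_neq m c d s : (m < l)%N -> d != c ->
  seq_occurrences l (nseq m c ++ d :: s) = seq_occurrences l (d :: s).
Proof.
move=> + neq_dc; elim: m => [|m IHm] // lt_ml /=.
rewrite seq_occurrences_cons (IHm (ltnW lt_ml)).
(* The run [c :: nseq m c] has length less than [l], so the front window reaches past it and
   contains both [c] and [d]. *)
have -> : constant (take l (c :: nseq m c ++ d :: s)) = false.
  case: l lt_ml => // l'; rewrite ltnS => lt_ml' /=.
  apply/negP => /allP/(_ d); rewrite take_cat size_nseq ltnNge (ltnW lt_ml') /=.
  rewrite mem_cat -(subnSK lt_ml') /= in_cons eqxx orbT => /(_ isT).
  by rewrite (negPf neq_dc).
by rewrite andbF.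
Qed.

(** The extra letter [c] creates only one new window, the front one, which is exactly the run of [l]
    copies of [c]. *)
Lemma seq_occurrences_nseq_full c s : (0 < l)%N ->
  seq_occurrences l (nseq l c ++ s) = (seq_occurrences l (nseq l.-1 c ++ s)).+1.
Proof.
case: l (seq_occurrences_cons c) => // l' occ_cons _ /=.
rewrite occ_cons size_cat size_nseq ltnS leq_addr /= take_size_cat ?size_nseq //.
by rewrite all_nseq /= eqxx orbT.
Qed.

End SeqOccurrences.

Lemma big_tuple_cons (V : nmodType) (T : finType) n (E : seq T -> V) :
  \sum_(w : n.+1.-tuple T) E w = \sum_(d : T) \sum_(w : n.-tuple T) E (d :: w).
Proof.
rewrite pair_bigA /= (reindex (fun p : T * n.-tuple T => [tuple of p.1 :: p.2])) //=.
exists (fun w : n.+1.-tuple T => (thead w, [tuple of behead w])).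
  by move=> [d w] _ /=; congr pair; apply: val_inj.
by move=> w _; rewrite /= -tuple_eta.
Qed.

(** * Coefficients of power series *)

Section PowerSeries.
Variable R : comNzRingType.

Lemma fps_coefXM (f : fps R) n :
  fps_coef (fps_of_poly 'X * f) n = if n is m.+1 then fps_coef f m else 0.
Proof.
rewrite -[LHS]/(\sum_(i < n.+1) ('X : {poly R})`_i * fps_coef f (n - i)%N).
case: n => [|n]; first by rewrite big_ord1 coefX mul0r.
rewrite 2!big_ord_recl !coefX mul0r add0r mul1r subn1 /= big1 ?addr0 // => i _.
by rewrite coefX mul0r.
Qed.

Lemma fps_coefCM (a : R) (f : fps R) n :
  fps_coef (fps_of_poly a%:P * f) n = a * fps_coef f n.
Proof.
rewrite -[LHS]/(\sum_(i < n.+1) (a%:P : {poly R})`_i * fps_coef f (n - i)%N).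
rewrite big_ord_recl coefC subn0 big1 ?addr0 // => i _.
by rewrite coefC mul0r.
Qed.

Lemma fps_coef_sum (I : Type) (r : seq I) (P : pred I) (f : I -> fps R) n :
  fps_coef (\sum_(i <- r | P i) f i) n = \sum_(i <- r | P i) fps_coef (f i) n.
Proof. by apply: (big_morph (fun f => fps_coef f n)). Qed.

Lemma fps_coef1 n : fps_coef (1 : fps R) n = (n == 0)%:R.
Proof. exact: coef1. Qed.

End PowerSeries.

(** * The linear system for words preceded by a run *)

Section RunGeneratingFunctions.
Variables (l k : nat).
Hypothesis l_gt0 : (0 < l)%N.

Let x : fps {poly int} := fps_of_poly 'X.
Let q : fps {poly int} := fps_of_poly ('X)%:P.

(** This is f_m of the overview: the prefix [nseq m c] affects the power of q, but the exponent of x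
    counts only the letters of [w]. *)
Definition F_run (m : nat) (c : 'I_k) : fps {poly int} :=
  Fps (fun n => \sum_(w : n.-tuple 'I_k) 'X ^+ seq_occurrences l (nseq m c ++ w)).

Lemma F_run0 c : F_run 0 c = F_tau l k.
Proof.
by apply: fpsP => n /=; apply: eq_bigr => w _; rewrite occurrencesE.
Qed.

Lemma F_run_full c : F_run l c = q * F_run l.-1 c.
Proof.
apply: fpsP => n; rewrite fps_coefCM /= mulr_sumr; apply: eq_bigr => w _.
by rewrite seq_occurrences_nseq_full // exprS.
Qed.

Lemma F_run_step m c : (m < l)%N ->
  F_run m c = 1 + x * (\sum_(d | d != c) F_run 1 d) + x * F_run m.+1 c.
Proof.
move=> lt_ml; apply: fpsP => n.
rewrite -[RHS]/(fps_coef 1 n + fps_coef (x * _) n + fps_coef (x * _) n).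
rewrite !fps_coefXM fps_coef1; case: n => [|n] /=.
  (* For empty [w] only the run of length [m < l] remains, which has no occurrence, so the constant
     term is 1. *)
  rewrite !addr0 (eq_bigr (fun=> 1)) => [|w _].
    by rewrite sumr_const card_tuple.
  by rewrite tuple0 cats0 seq_occurrences_small ?size_nseq.
rewrite add0r fps_coef_sum addrC.
rewrite (big_tuple_cons n (fun w => 'X ^+ seq_occurrences l (nseq m c ++ w))).
rewrite (bigD1 c) //=; congr (_ + _).
  apply: eq_bigr => w _.
  by rewrite -[c :: nseq m c ++ w]/(nseq m.+1 c ++ w) -addn1 nseqD -catA.
apply: eq_bigr => d neq_dc; apply: eq_bigr => w _.
by rewrite seq_occurrences_nseq_neq.
Qed.

Lemma F_tau_step : F_tau l k = 1 + x * (\sum_d F_run 1 d).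
Proof.
apply: fpsP => n.
rewrite -[RHS]/(fps_coef 1 n + fps_coef (x * _) n) fps_coefXM fps_coef1.
case: n => [|n] /=.
  rewrite addr0 (eq_bigr (fun=> 1)) => [|w _].
    by rewrite sumr_const card_tuple.
  by rewrite occurrencesE tuple0 seq_occurrences_small.
rewrite add0r fps_coef_sum.
rewrite (eq_bigr (fun w : n.+1.-tuple _ => 'X ^+ seq_occurrences l w)) => [|w _].
  by rewrite (big_tuple_cons n (fun w => 'X ^+ seq_occurrences l w)).
by rewrite occurrencesE.
Qed.

Let N : fps {poly int} := 1 + (1 - q) * \sum_(1 <= i < l) x ^+ i.

Lemma sum_powers_from1 :
  \sum_(1 <= i < l) x ^+ i = x * \sum_(0 <= i < l.-1) x ^+ i.
Proof.
rewrite mulr_sumr -{1}(prednK l_gt0) big_add1 /=.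
by apply: eq_bigr => i _; rewrite exprS.
Qed.

Lemma F_tau_letter c :
  F_tau l k * (1 - q * x) = (1 + x * (\sum_(d | d != c) F_run 1 d)) * N.
Proof.
set G := 1 + x * _.
have unroll m : (m < l)%N ->
    F_tau l k = G * \sum_(0 <= i < m) x ^+ i + x ^+ m * F_run m c.
  elim: m => [|m IHm] lt_ml; first by rewrite big_geq // F_run0; ring.
  rewrite (IHm (ltnW lt_ml)) (F_run_step _ (ltnW lt_ml)) -/G big_nat_recr //= exprS.
  ring.
(* At [m = l.-1] the step leads to [F_run l c], which is [q * F_run l.-1 c]; this closes the
   system. *)
have last_run : F_run l.-1 c * (1 - q * x) = G.
  have : F_run l.-1 c = G + x * (q * F_run l.-1 c).
    by rewrite -F_run_full -{2}(prednK l_gt0) -F_run_step ?prednK.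
  by move/(canLR (addrK _)) <-; ring.
set S := \sum_(0 <= i < l.-1) x ^+ i.
(* Both sides are 1 + x + ... + x^(l-1). *)
have geom1 : S + x ^+ l.-1 = 1 + x * S.
  have : x ^+ l.-1 - 1 = (x - 1) * S by rewrite subrX1 /S big_mkord.
  by move/(canRL (subrK 1)) ->; ring.
rewrite /N sum_powers_from1 (unroll l.-1) ?prednK // -/S mulrDl -!mulrA last_run.
transitivity (G * (S + x ^+ l.-1 - q * x * S)); first by ring.
by rewrite geom1; ring.
Qed.

Lemma F_tau_eq :
  F_tau l k * (k%:R * (1 - q * x) - (k%:R - 1) * N) = N.
Proof.
(* Each [F_run 1 d] is missing from exactly one of the [k] inner sums, the one with [c = d]. *)
have sum_letters : \sum_(c : 'I_k) \sum_(d | d != c) F_run 1 d =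
    (k%:R - 1) * \sum_d F_run 1 d.
  transitivity (\sum_(c : 'I_k) (\sum_d F_run 1 d - F_run 1 c)).
    by apply: eq_bigr => c _; rewrite [in RHS](bigD1 c) //=; ring.
  by rewrite sumrB sumr_const card_ord -mulr_natl; ring.
have : \sum_(c : 'I_k) F_tau l k * (1 - q * x) =
    \sum_(c : 'I_k) (1 + x * (\sum_(d | d != c) F_run 1 d)) * N.
  by apply: eq_bigr => c _; rewrite (F_tau_letter c).
rewrite sumr_const card_ord -mulr_suml big_split sumr_const card_ord /=.
rewrite -mulr_sumr sum_letters -[_ * _ *+ k]mulr_natl => sum_eq.
(* The summed equation becomes k F (1 - q x) = (k + (k - 1)(F - 1)) N; moving (k - 1) F N to the
   left leaves N. *)
have step : x * (\sum_d F_run 1 d) = F_tau l k - 1 by rewrite F_tau_step; ring.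
transitivity (k%:R * (F_tau l k * (1 - q * x)) - F_tau l k * (k%:R - 1) * N).
  by ring.
rewrite sum_eq mulrCA step. ring.
Qed.

(** The constant coefficient of [N] is 1. Nonvanishing of [N] later yields that of the
    denominator. *)
Lemma numerator_neq0 : N != 0.
Proof.
apply/eqP => /(congr1 (fun f => fps_coef f 0)).
rewrite /N sum_powers_from1 mulrCA.
rewrite -[LHS]/(fps_coef 1 0 + fps_coef (x * _) 0) fps_coefXM fps_coef1 addr0.
by move/eqP; rewrite oner_eq0.
Qed.

End RunGeneratingFunctions.

(** * Closed forms of the numerator and denominator *)

Lemma numerator_sum (R : comNzRingType) (x y : R) (k m : nat) : y = k%:R * x ->
  x * \sum_(0 <= j < m) y ^+ j
    - (k%:R - 1) * \sum_(2 <= d < m.+1) x ^+ d * \sum_(0 <= j < m.+1 - d) y ^+ j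
  = \sum_(1 <= i < m.+1) x ^+ i.
Proof.
move=> y_def.
have powersS n : \sum_(0 <= j < n.+1) y ^+ j = 1 + y * \sum_(0 <= j < n) y ^+ j.
  rewrite big_nat_recl // mulr_sumr; congr (_ + _).
  by apply: eq_bigr => j _; rewrite exprS.
(* Write L_m for the left side and P_m = x + ... + x^m. Then L_(m+1) = x + y L_m - (k - 1) x P_m,
   which for L_m = P_m and y = k x equals x + x P_m = P_(m+1). *)
elim: m => [|m IHm]; first by rewrite !big_geq //; ring.
have -> : \sum_(2 <= d < m.+2) x ^+ d * \sum_(0 <= j < m.+2 - d) y ^+ j =
    \sum_(2 <= d < m.+2) x ^+ d
    + y * \sum_(2 <= d < m.+1) x ^+ d * \sum_(0 <= j < m.+1 - d) y ^+ j.
  transitivity (\sum_(2 <= d < m.+2)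
      (x ^+ d + y * (x ^+ d * \sum_(0 <= j < m.+1 - d) y ^+ j))).
    apply: eq_big_nat => d /andP[_ lt_d]; rewrite subSn // powersS; ring.
  rewrite big_split -mulr_sumr /=; congr (_ + y * _).
  case: m {IHm} => [|m]; first by rewrite !big_geq.
  by rewrite big_nat_recr //= subnn (big_geq (leqnn 0)) mulr0 addr0.
have shift : \sum_(2 <= d < m.+2) x ^+ d = x * \sum_(1 <= i < m.+1) x ^+ i.
  by rewrite big_add1 mulr_sumr; apply: eq_bigr => i _; rewrite exprS.
rewrite powersS [in RHS]big_ltn // expr1 shift -IHm y_def; ring.
Qed.

(** After multiplication by 1 - x both sides equal x^2 - x^l. The exponent is an integer since it is
    -1 for [l = 1], whence the condition [x != 0]. *)
Lemma denominator_sum (K : fieldType) (x : K) (l : nat) : (0 < l)%N ->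
  x != 0 -> 1 - x != 0 ->
  (1 - x ^ (l%:Z - 2)) * (x ^+ 2 / (1 - x)) = \sum_(1 <= i < l) x ^+ i - x.
Proof.
move=> l_gt0 x_neq0 x_neq1.
have geom : (1 - x) * \sum_(1 <= i < l) x ^+ i = x - x ^+ l.
  case: l l_gt0 => // m _; elim: m => [|m IHm].
    by rewrite big_geq // expr1; ring.
  by rewrite big_nat_recr //= mulrDr IHm [in RHS]exprS; ring.
apply: (mulfI x_neq1); rewrite mulrBr geom expfzDr // -exprnP -exprnN.
by field; rewrite x_neq1 x_neq0.
Qed.

Lemma fraction_form (K : fieldType) (x q f : K) (k l : nat) : (0 < l)%N ->
  x != 0 -> 1 - x != 0 ->
  let N := 1 + (1 - q) * \sum_(1 <= i < l) x ^+ i in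
  N != 0 -> f * (k%:R * (1 - q * x) - (k%:R - 1) * N) = N ->
  f =
    (1 + (1 - q) * x * \sum_(0 <= j < l.-1) (k%:R * x) ^+ j
       - (1 - q) * (k%:R - 1) *
           \sum_(2 <= d < l) x ^+ d * \sum_(0 <= j < l - d) (k%:R * x) ^+ j)
    / (1 - (k%:R - 1 + q) * x
       - (k%:R - 1) * (1 - q) * (1 - x ^ (l%:Z - 2)) * (x ^+ 2 / (1 - x))).
Proof.
move=> l_gt0 x_neq0 x_neq1 N N_neq0 f_eq; set y := k%:R * x.
have num_eq : 1 + (1 - q) * x * \sum_(0 <= j < l.-1) y ^+ j
    - (1 - q) * (k%:R - 1) *
        \sum_(2 <= d < l) x ^+ d * \sum_(0 <= j < l - d) y ^+ j = N.
  have := numerator_sum l.-1 (erefl y); rewrite prednK // /N => <-; ring.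
have den_eq : 1 - (k%:R - 1 + q) * x
    - (k%:R - 1) * (1 - q) * (1 - x ^ (l%:Z - 2)) * (x ^+ 2 / (1 - x))
    = k%:R * (1 - q * x) - (k%:R - 1) * N.
  by rewrite -mulrA denominator_sum // /N; ring.
rewrite num_eq den_eq -{1}f_eq mulfK //.
(* If the denominator vanished, [f_eq] would force [N = 0]. *)
by apply: contraNneq N_neq0 => den0; rewrite -f_eq den0 mulr0.
Qed.

Theorem theorem2p1 (l k : nat) (hl : (1 <= l)%N) (hk : (1 <= k)%N) :
  let x : {fraction fps {poly int}} := tofrac (fps_of_poly 'X) in
  let q : {fraction fps {poly int}} := tofrac (fps_of_poly ('X)%:P) in
  tofrac (F_tau l k) =
    (1 + (1 - q) * x * \sum_(0 <= j < l.-1) (k%:R * x) ^+ j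
       - (1 - q) * (k%:R - 1) *
           \sum_(2 <= d < l) x ^+ d * \sum_(0 <= j < l - d) (k%:R * x) ^+ j)
    / (1 - (k%:R - 1 + q) * x
       - (k%:R - 1) * (1 - q) * (1 - x ^ (l%:Z - 2)) * (x ^+ 2 / (1 - x))).
Proof.
move=> x q.
have x_def : x = tofrac (fps_of_poly 'X) by [].
have x_neq0 : x != 0.
  rewrite x_def tofrac_eq0 -(rmorph0 (@fps_of_poly _)).
  by rewrite (inj_eq (@fps_of_poly_inj _)) polyX_eq0.
have x_neq1 : 1 - x != 0.
  rewrite x_def -tofrac1 -tofracB tofrac_eq0 -(rmorph1 (@fps_of_poly _)) -rmorphB.
  rewrite -(rmorph0 (@fps_of_poly _)) (inj_eq (@fps_of_poly_inj _)) subr_eq0.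
  by apply/eqP => /polyP/(_ 0); rewrite coef1 coefX => /eqP; rewrite oner_eq0.
set N := 1 + (1 - q) * \sum_(1 <= i < l) x ^+ i.
(* [N] is the image of a power series, so its nonvanishing and the linear equation for [F_tau]
   transfer along [tofrac]. *)
have N_def : N =
    tofrac (1 + (1 - fps_of_poly ('X)%:P) * \sum_(1 <= i < l) fps_of_poly 'X ^+ i).
  rewrite rmorphD rmorph1 rmorphM rmorphB rmorph1 rmorph_sum.
  by congr (1 + _ * _); apply: eq_bigr => i _; rewrite rmorphXn.
apply: fraction_form => //; rewrite -/N.
  by rewrite N_def tofrac_eq0 numerator_neq0.
rewrite [in RHS]N_def -(F_tau_eq k hl) N_def.
by rewrite !(rmorphM, rmorphB, rmorph1, rmorph_nat).
Qed.
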